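(* There exist a polynomial $$P(t)=\sum_{k=0}^n\gamma_kf_k\left(\frac t2\right)$$ and numbers $\tau_1>0$ and $\tau_2<0$ such that $P(t)$ has only real zeros, but the polynomials $t\mapsto M_P(\tau_1,t)$ and $t\mapsto M_P(\tau_2,t)$ both have non-real zeros.
   Context: The polynomials $f_n$ (Meixner--Pollaczek polynomials $P_n^{(3/4)}(x;\pi/2)$) are $$f_n(x)=\frac{(3/2)_n}{n!}\,i^n\,{}_2F_1\left(-n,\tfrac34+ix;\tfrac32;2\right),$$ where $(a)_n=a(a+1)\cdots(a+n-1)$; $f_n$ has degree $n$. For a polynomial $P(t)=\sum_{k=0}^n\gamma_kf_k(t/2)$, the Poisson flow associated with the family $(f_k)_{k\ge0}$ with initial condition $P$ is $$M_P(\tau,t)=\sum_{k=0}^n\gamma_ke^{-k\tau}f_k\left(\frac t2\right)\qquad(\tau\in\mathbb{R},\ t\in\mathbb{C}).$$ *)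

(* Defs.v *)
From mathcomp Require Import all_boot all_order all_algebra.
From mathcomp Require Import all_classical all_reals all_analysis.
From mathcomp Require Import complex.

Set Implicit Arguments.
Unset Strict Implicit.
Unset Printing Implicit Defensive.

Import Order.TTheory GRing.Theory Num.Theory.
Local Open Scope ring_scope.
Local Open Scope complex_scope.

Definition rising (A : nzRingType) (a : A) (k : nat) : A :=
  \prod_(j < k) (a + j%:R).

(* 2F1(-n, b; c; z). The numerator parameter -n makes every term of index
   k > n vanish, so the series is this finite sum and z is unrestricted. *)
Definition hyp2F1_neg (C : fieldType) (n : nat) (b c z : C) : C :=
  \sum_(k < n.+1)
    rising (- n%:R) k * rising b k / rising c k * (z ^+ k / (k`!)%:R).

(* The Meixner-Pollaczek polynomial P_n^(3/4)(x; pi/2). *)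
Definition mpoll (R : realType) (n : nat) (x : R[i]) : R[i] :=
  rising (3%:R / 2%:R) n / (n`!)%:R * 'i%C ^+ n
  * hyp2F1_neg n (3%:R / 4%:R + 'i%C * x) (3%:R / 2%:R) 2%:R.

Definition mpoll_expansion (R : realType) (n : nat) (gamma : 'I_n.+1 -> R[i])
    (t : R[i]) : R[i] :=
  \sum_(k < n.+1) gamma k * mpoll k (t / 2%:R).

Definition poisson_flow (R : realType) (n : nat) (gamma : 'I_n.+1 -> R[i])
    (tau : R) (t : R[i]) : R[i] :=
  \sum_(k < n.+1)
    gamma k * (expR (- (k%:R * tau)))%:C * mpoll k (t / 2%:R).

(* Main.v *)
Require Import Defs.
From mathcomp Require Import all_boot all_order all_algebra.
From mathcomp Require Import all_classical all_reals all_analysis.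
From mathcomp Require Import complex.
From mathcomp Require Import ring lra.
Import Order.TTheory GRing.Theory Num.Theory.
Local Open Scope ring_scope.
Local Open Scope complex_scope.

(** The polynomial [P(t) = t ^ 4] has the required property.  Its expansion is
    [24 f_4(t/2) + 34 f_2(t/2) + 39/4], where [2 f_2(t/2) = t^2 - 3/2] and
    [24 f_4(t/2) = t^4 - 17 t^2 + 63/4].  With [q = e ^ (2 tau)] the flow is
    [q ^ -2 * (t^4 + b(q) t^2 + c(q))], where
    [b(q) = 17 (q - 1)] and [c(q) = 3/4 (q - 1) (13 q - 21)].

    A biquadratic [t^4 + b t^2 + c] with only real zeros is a quadratic in
    [t^2] with two nonnegative roots, so both its constant term [c] and its
    discriminant [b^2 - 4 c] are nonnegative ([biquadratic_nonreal_root]).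
    Here the discriminant is [(q - 1) (250 q - 226)].  Both quantities vanish
    to first order at [q = 1], but with opposite signs: just after time [0] the
    constant term is negative (for [1 < q < 21/13]), and just before time [0]
    the discriminant is negative (for [113/125 < q < 1]).  So the quadruple
    zero of [P] splits off non-real zeros in both directions of time. *)

(** Let [u] and [v] be the roots of [X^2 + b X + c].  If their square roots
    were all real, then [u, v >= 0], whence [c = u v >= 0] and
    [b^2 - 4 c = (u - v)^2 >= 0].  The comparison [0 <= z] also says
    that [z] is real, so [b] and [c] may be arbitrary complex numbers. *)
Lemma biquadratic_nonreal_root (C : numClosedFieldType) (b c : C) :
  ~~ ((0 <= c) && (0 <= b ^+ 2 - 4%:R * c)) ->
  exists t : C, t ^+ 4 + b * t ^+ 2 + c = 0 /\ t \isn't Num.real.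
Proof.
move=> Hneg.
pose d := sqrtC (b ^+ 2 - 4%:R * c).
have d2 : d ^+ 2 = b ^+ 2 - 4%:R * c by rewrite sqrtCK.
pose u := (d - b) / 2%:R; pose v := (- d - b) / 2%:R.
have uv : u * v = c.
  have -> : u * v = (b ^+ 2 - d ^+ 2) / 4%:R by rewrite /u /v; field.
  by rewrite d2; field.
have subuv : (u - v) ^+ 2 = b ^+ 2 - 4%:R * c by rewrite -d2 /u /v; field.
have rootE w : (w - u) * (w - v) = 0 ->
    sqrtC w ^+ 4 + b * sqrtC w ^+ 2 + c = 0.
  by move=> <-; rewrite (exprM _ 2 2) sqrtCK -uv /u /v; field.
have ru : sqrtC u ^+ 4 + b * sqrtC u ^+ 2 + c = 0.
  by rewrite rootE // subrr mul0r.
have rv : sqrtC v ^+ 4 + b * sqrtC v ^+ 2 + c = 0.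
  by rewrite rootE // subrr mulr0.
have [su|su] := boolP (sqrtC u \is Num.real); last by exists (sqrtC u).
have [sv|sv] := boolP (sqrtC v \is Num.real); last by exists (sqrtC v).
have u0 : 0 <= u by rewrite -(sqrtCK u) real_exprn_even_ge0.
have v0 : 0 <= v by rewrite -(sqrtCK v) real_exprn_even_ge0.
case/negP: Hneg.
by rewrite -subuv -uv mulr_ge0 //= real_exprn_even_ge0 // rpredB ?ger0_real.
Qed.

Definition t4_coeff (R : realType) (k : 'I_5) : R[i] :=
  nth 0 [:: 39%:R / 4%:R; 0; 34%:R; 0; 24%:R] k.

(** The shift [b = 3/4 + y] is half of [c = 3/2] plus [y].  For this
    [b] and at the argument [2], the Pfaff reflection [b -> c - b] changes the
    sum by the factor [(-1)^n], so for even [n] it is even in [y].  Writing it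
    through [y^2] keeps the later substitution [y = i x] real. *)
Lemma hyp2F1_neg2 (F : numFieldType) (y : F) :
  hyp2F1_neg 2 (3%:R / 4%:R + y) (3%:R / 2%:R) 2%:R
  = (4%:R * y ^+ 2 + 3%:R / 2%:R) / (15%:R / 4%:R).
Proof.
rewrite /hyp2F1_neg /rising !big_ord_recr !big_ord0 /= !factS fact0.
by field.
Qed.

Lemma hyp2F1_neg4 (F : numFieldType) (y : F) :
  hyp2F1_neg 4 (3%:R / 4%:R + y) (3%:R / 2%:R) 2%:R
  = (16%:R * (y ^+ 2) ^+ 2 + 68%:R * y ^+ 2 + 63%:R / 4%:R) / (945%:R / 16%:R).
Proof.
rewrite /hyp2F1_neg /rising !big_ord_recr !big_ord0 /= !factS fact0.
by field.
Qed.

Lemma mpoll0 (R : realType) (x : R[i]) : mpoll 0 x = 1.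
Proof.
rewrite /mpoll /hyp2F1_neg /rising !big_ord_recr !big_ord0 /= fact0.
by field.
Qed.

Lemma mpoll2 (R : realType) (t : R[i]) :
  mpoll 2 (t / 2%:R) = (t ^+ 2 - 3%:R / 2%:R) / 2%:R.
Proof.
rewrite /mpoll hyp2F1_neg2 exprMn sqr_i.
rewrite /rising !big_ord_recr !big_ord0 /= !factS fact0.
by field.
Qed.

Lemma mpoll4 (R : realType) (t : R[i]) :
  mpoll 4 (t / 2%:R) = (t ^+ 4 - 17%:R * t ^+ 2 + 63%:R / 4%:R) / 24%:R.
Proof.
have iy2 : ('i%C * (t / 2%:R)) ^+ 2 = - (t / 2%:R) ^+ 2 :> R[i].
  by rewrite exprMn sqr_i mulN1r.
rewrite /mpoll hyp2F1_neg4 (exprM 'i%C 2 2) iy2 sqr_i.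
rewrite /rising !big_ord_recr !big_ord0 /= !factS fact0.
by field.
Qed.

Lemma poisson_flow_t4 (R : realType) (s : R) (t : R[i]) : 0 < s ->
  let q := (s ^+ 2)%:C in
  poisson_flow (@t4_coeff R) (ln s) t
  = q ^- 2 * (t ^+ 4 + (17%:R * (q - 1)) * t ^+ 2
              + 3%:R / 4%:R * (q - 1) * (13%:R * q - 21%:R)).
Proof.
move=> s0 q.
have expE k : (expR (- (k%:R * ln s)))%:C = s%:C ^- k.
  by rewrite expRN expRM_natl lnK ?posrE // fmorphV rmorphXn.
have sN0 : s%:C != 0 by rewrite fmorph_eq0 gt_eqF.
rewrite /poisson_flow /t4_coeff !big_ord_recr big_ord0 /= !expE.
rewrite mpoll0 mpoll2 mpoll4 /q rmorphXn.
by field.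
Qed.

Theorem proposition3p9 (R : realType) :
  exists (P : {poly R[i]}) (n : nat) (gamma : 'I_n.+1 -> R[i])
         (tau1 tau2 : R),
    [/\ forall t : R[i], P.[t] = mpoll_expansion gamma t,
        0 < tau1,
        tau2 < 0,
        forall t : R[i], root P t -> t \is Num.real
      & (exists t : R[i],
           poisson_flow gamma tau1 t = 0 /\ t \isn't Num.real) /\
        (exists t : R[i],
           poisson_flow gamma tau2 t = 0 /\ t \isn't Num.real)].
Proof.
(* The times are chosen so that [q = s ^ 2] lies in the two intervals where
   the constant term, respectively the discriminant, is negative. *)
pose s1 : R := 6%:R / 5%:R; pose s2 : R := 24%:R / 25%:R.
have flow_root (s : R) : 0 < s ->
    let b := 17%:R * (s ^+ 2 - 1) in
    let c := 3%:R / 4%:R * (s ^+ 2 - 1) * (13%:R * s ^+ 2 - 21%:R) in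
    (c < 0) || (b ^+ 2 - 4%:R * c < 0) ->
    exists t : R[i],
      poisson_flow (@t4_coeff R) (ln s) t = 0 /\ t \isn't Num.real.
  move=> s0 b c neg.
  have [|t [rt nt]] := @biquadratic_nonreal_root R[i] b%:C c%:C.
    have -> : b%:C ^+ 2 - 4%:R * c%:C = (b ^+ 2 - 4%:R * c)%:C.
      by move: (b) (c) => b' c'; rewrite rmorphB rmorphXn rmorphM rmorph_nat.
    by rewrite !lecR negb_and -!ltNge.
  exists t; split=> //.
  rewrite poisson_flow_t4 //.
  apply/eqP; rewrite mulf_eq0; apply/orP; right; apply/eqP.
  by rewrite -[RHS]rt /b /c !(rmorphM, rmorphB, rmorph_nat, rmorph1, fmorphV).
exists ('X^4), 4%N, (@t4_coeff R), (ln s1), (ln s2); split.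
- move=> t; rewrite /mpoll_expansion /t4_coeff !big_ord_recr big_ord0 /=.
  by rewrite mpoll0 mpoll2 mpoll4 hornerXn; field.
- by apply: ln_gt0; rewrite /s1; lra.
- by apply: ln_lt0; rewrite /s2; apply/andP; split; lra.
- move=> t; rewrite /root hornerXn expf_eq0 => /andP[_ /eqP ->].
  exact: rpred0.
- by split; apply: flow_root; rewrite /s1 /s2; lra.
Qed.
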